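(* Let $B$ be a subset of the Cantor space $2^\omega$. Then the following are equivalent: (a) $B$ is ${\bf\Sigma}^0_3$ (i.e. $G_{\delta\sigma}$) and $\lambda(B)=0$; (b) there is a martingale $f$ with $B=D(f)$.
   Context: $2^{<\omega}$ is the set of finite binary sequences, $2^\omega$ the Cantor space with its usual topology, and $\lambda$ the Lebesgue (fair coin-tossing) product probability measure on $2^\omega$. For $\beta\in 2^\omega$ and $l\in\omega$, $\beta|l$ is the initial segment of $\beta$ of length $l$. A martingale is a map $f:2^{<\omega}\to[0,1]$ such that $f(s)=\frac{f(s0)+f(s1)}{2}$ for each $s\in 2^{<\omega}$. For a martingale $f$ and $\beta\in2^\omega$, the oscillation of $f$ at $\beta$ is $\mathrm{osc}(f,\beta):=\inf_{N\in\omega}\sup_{p,q\geq N}|f(\beta|p)-f(\beta|q)|$. The set of divergence of $f$ is $D(f):=\{\beta\in2^\omega\mid \mathrm{osc}(f,\beta)>0\}$. *)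

(* Defs.v *)
From HB Require Import structures.
From mathcomp Require Import all_boot all_order all_algebra finmap.
From mathcomp Require Import all_classical all_reals all_analysis borel_hierarchy.

Set Implicit Arguments.
Unset Strict Implicit.
Unset Printing Implicit Defensive.

Import Order.TTheory GRing.Theory Num.Theory.
Import numFieldNormedType.Exports.

Local Open Scope classical_set_scope.
Local Open Scope ring_scope.

Definition restr (beta : cantor_space) (l : nat) : seq bool :=
  mkseq (beta : nat -> bool) l.

Lemma size_restr beta l : size (restr beta l) = l.
Proof. exact: size_mkseq. Qed.

Lemma restrS beta l : restr beta l.+1 = rcons (restr beta l) (beta l).
Proof. by rewrite /restr /mkseq -addn1 iotaD map_cat cats1. Qed.

Lemma restr_le m n beta gamma : (m <= n)%N ->
  restr beta n = restr gamma n -> restr beta m = restr gamma m.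
Proof.
move=> mn E; have K (b : cantor_space) : restr b m = take m (restr b n).
  by rewrite /restr /mkseq -map_take take_iota (minn_idPl mn).
by rewrite !K E.
Qed.

Definition cylinder (s : seq bool) : set cantor_space :=
  [set beta | restr beta (size s) = s].

Lemma cylinder_rcons s b : cylinder (rcons s b) `<=` cylinder s.
Proof.
move=> beta; rewrite /cylinder /= size_rcons restrS => /rcons_inj[].
by [].
Qed.

Definition pad (s : seq bool) : cantor_space := nth false s.

Lemma cylinder_pad s : cylinder s (pad s).
Proof. exact: mkseq_nth. Qed.

(* [A] is a union of cylinders of length [n] *)
Definition determined (n : nat) (A : set cantor_space) :=
  forall beta gamma, restr beta n = restr gamma n -> A beta -> A gamma.

Definition cylinder_set (A : set cantor_space) := exists n, determined n A.

Lemma determined_le m n A : (m <= n)%N -> determined m A -> determined n A.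
Proof. by move=> mn dA b c /(restr_le mn); exact: dA. Qed.

Lemma determinedP n A s : size s = n -> determined n A ->
  cylinder s `<=` A <-> A (pad s).
Proof.
move=> sn dA; split=> [|As b bs]; first by apply; exact: cylinder_pad.
apply: dA As; have := cylinder_pad s; rewrite /cylinder /= -sn => ->.
exact/esym.
Qed.

Lemma determinedU n A B : determined n A -> determined n B ->
  determined n (A `|` B).
Proof.
by move=> dA dB b c E [/(dA _ _ E)|/(dB _ _ E)]; [left|right].
Qed.

Lemma determined_cylinder s : determined (size s) (cylinder s).
Proof. by move=> b c E; rewrite /cylinder/= E. Qed.

Lemma cylinder_set0 : cylinder_set set0.
Proof. by exists 0%N. Qed.

Lemma cylinder_setU : setU_closed cylinder_set.
Proof.
move=> A B [m dA] [n dB]; exists (maxn m n); apply: determinedU.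
  by apply: determined_le dA; exact: leq_maxl.
by apply: determined_le dB; exact: leq_maxr.
Qed.

Lemma cylinder_setC : setC_closed cylinder_set.
Proof. by move=> A [n dA]; exists n => b c E nA /(dA _ _ (esym E)). Qed.

Definition cylinder_space : Type := cantor_space.

HB.instance Definition _ := Pointed.on cylinder_space.
HB.instance Definition _ :=
  isAlgebraOfSets.Build default_measure_display cylinder_space
    cylinder_set0 cylinder_setU cylinder_setC.

Definition cantor_measurableType :=
  g_sigma_algebraType (@measurable _ cylinder_space).

Lemma open_cylinder_set A : cylinder_set A -> open A.
Proof.
move=> [n dA]; have cv (b : cantor_space) : nbhs b [set c | restr b n = restr c n].
  elim: n {dA} => [|n IHn]; first by apply: filterE => c; rewrite /restr.
  have cb : nbhs b [set c : cantor_space | c n = b n].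
    exact: (@proj_continuous nat (fun _ => bool) n b _ (discrete_set1 (b n))).
  apply: filterS (filterI IHn cb) => c [/= E Ec].
  by rewrite !restrS E Ec.
rewrite openE => b Ab; rewrite /interior.
by apply: filterS (cv b) => c /= /dA; exact.
Qed.

Section coin_content.
Context {R : realType}.
Implicit Types (A B : set cantor_space) (n : nat).
Local Open Scope ereal_scope.

Definition cylinder_count n A : nat :=
  #|[set s : n.-tuple bool | `[< cylinder s `<=` A >]]%SET|.

Definition cylinder_density n A : \bar R :=
  ((cylinder_count n A)%:R / 2 ^+ n)%:E.

(* For a cylinder set the densities are eventually constant; [coin_content]
   is then their common value. *)
Definition coin_content (A : set cylinder_space) : \bar R :=
  ereal_sup [set cylinder_density n A | n in [set: nat]].

Lemma card_tupleS n (P : pred (seq bool)) :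
  #|[set s : n.+1.-tuple bool | P s]%SET| =
  (#|[set s : n.-tuple bool | P (rcons s false)]%SET| +
   #|[set s : n.-tuple bool | P (rcons s true)]%SET|)%N.
Proof.
rewrite -!sum1_card.
pose h (p : bool * n.-tuple bool) : n.+1.-tuple bool := [tuple of rcons p.2 p.1].
have bh : bijective h.
  apply: inj_card_bij.
    move=> [b s] [c t] /(congr1 val)/= /rcons_inj[] /val_inj -> ->.
    by [].
  by rewrite card_prod !card_tuple card_bool expnS.
rewrite (reindex h) /=; last exact: onW_bij.
under eq_bigl do rewrite inE.
rewrite -(pair_big_dep xpredT (fun b (s : n.-tuple bool) => P (rcons s b))
  (fun _ _ => 1%N))/= big_bool addnC.
by congr (_ + _)%N; apply: eq_bigl => s; rewrite inE.
Qed.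

Lemma cylinder_countS n A :
  (2 * cylinder_count n A <= cylinder_count n.+1 A)%N.
Proof.
rewrite /cylinder_count.
rewrite (card_tupleS n (fun s : seq bool => `[< cylinder s `<=` A >])).
rewrite mul2n -addnn; apply: leq_add; apply: subset_leq_card;
  by apply/fintype.subsetP => s; rewrite !finset.inE => /asboolP sA;
     apply: asboolT => b /cylinder_rcons/sA.
Qed.

Lemma cylinder_countSE n A : determined n A ->
  cylinder_count n.+1 A = (2 * cylinder_count n A)%N.
Proof.
move=> dA; rewrite /cylinder_count.
rewrite (card_tupleS n (fun s : seq bool => `[< cylinder s `<=` A >])).
rewrite mul2n -addnn.
have H (b : bool) : [set s : n.-tuple bool | `[< cylinder (rcons s b) `<=` A >]]%SET =
    [set s : n.-tuple bool | `[< cylinder s `<=` A >]]%SET.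
  apply/setP => s; rewrite !inE; apply: asbool_equiv_eq; split.
    move=> sA; apply/(determinedP (size_tuple s) dA).
    have := sA _ (cylinder_pad (rcons s b)); apply: dA.
    have := cylinder_rcons (cylinder_pad (rcons s b)).
    have := cylinder_pad s.
    by rewrite /cylinder/= size_tuple => -> ->.
  by move=> sA c /cylinder_rcons/sA.
by rewrite !H.
Qed.

Lemma cylinder_densityS n A : cylinder_density n A <= cylinder_density n.+1 A.
Proof.
rewrite lee_fin exprS invfM mulrA ler_pM2r ?invr_gt0 ?exprn_gt0//.
by rewrite ler_pdivlMr// -natrM ler_nat mulnC cylinder_countS.
Qed.

Lemma cylinder_density_le m n A : (m <= n)%N ->
  cylinder_density m A <= cylinder_density n A.
Proof.
move=> /subnK <-; elim: (n - m)%N => // k /le_trans; apply.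
by rewrite addSn; exact: cylinder_densityS.
Qed.

Lemma cylinder_densityE m n A : determined m A -> (m <= n)%N ->
  cylinder_density n A = cylinder_density m A.
Proof.
move=> dA /subnK <-; elim: (n - m)%N => // k <-.
rewrite addSn /cylinder_density cylinder_countSE; last first.
  by apply: determined_le dA; exact: leq_addl.
by rewrite natrM exprS -mulf_div divff ?mul1r.
Qed.

Lemma coin_contentE n A : determined n A ->
  coin_content A = cylinder_density n A.
Proof.
move=> dA; apply/eqP; rewrite eq_le; apply/andP; split.
  apply: ge_ereal_sup => _ [m _ <-].
  have [mn|/ltnW nm] := leqP m n; first exact: cylinder_density_le.
  by rewrite (cylinder_densityE dA nm).
by apply: ereal_sup_ubound; exists n.
Qed.

Lemma coin_content_ge0 A : 0 <= coin_content A.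
Proof.
apply: (@le_trans _ _ (cylinder_density 0 A)); first by rewrite lee_fin divr_ge0.
by apply: ereal_sup_ubound; exists 0%N.
Qed.

Lemma coin_content0 : coin_content set0 = 0.
Proof.
rewrite (@coin_contentE 0%N)// /cylinder_density /cylinder_count.
rewrite (_ : [set _ | _]%SET = finset.set0) ?cards0 ?mul0r//.
apply/setP => s; rewrite !inE; apply/asboolP => /(_ _ (cylinder_pad s)).
by [].
Qed.

Lemma coin_contentU A B : cylinder_set A -> cylinder_set B ->
  A `&` B = set0 -> coin_content (A `|` B) = coin_content A + coin_content B.
Proof.
move=> [m dA] [n dB] AB0.
have {}dA := determined_le (leq_maxl m n) dA.
have {}dB := determined_le (leq_maxr m n) dB.
set k := maxn m n in dA dB.
rewrite (coin_contentE (determinedU dA dB)) (coin_contentE dA) (coin_contentE dB).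
rewrite /cylinder_density -EFinD -mulrDl -natrD; congr ((_%:R / _)%:E).
rewrite /cylinder_count -cardsUI.
set X := [set s : k.-tuple bool | `[< cylinder s `<=` A >]]%SET.
set Y := [set s : k.-tuple bool | `[< cylinder s `<=` B >]]%SET.
have -> : finset.setI X Y = finset.set0.
  apply/setP => s; rewrite !inE; apply/negP => /andP[/asboolP sA /asboolP sB].
  suff : (A `&` B) (pad s) by rewrite AB0.
  by split; [apply: sA|apply: sB]; exact: cylinder_pad.
rewrite cards0 addn0; congr #|pred_of_set _|.
apply/setP => s; rewrite !inE -asbool_or; apply: asbool_equiv_eq.
rewrite (determinedP (size_tuple s) dA) (determinedP (size_tuple s) dB).
exact: (determinedP (size_tuple s) (determinedU dA dB)).
Qed.

Lemma cylinder_set_bigU (F : (set cantor_space)^nat) n :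
  (forall i, cylinder_set (F i)) ->
  cylinder_set (\big[setU/set0]_(i < n) F i).
Proof.
move=> mF; elim/big_ind : _ => //; first exact: cylinder_set0.
exact: cylinder_setU.
Qed.

Lemma coin_content_sum (F : (set cantor_space)^nat) n :
  (forall i, cylinder_set (F i)) -> trivIset setT F ->
  \sum_(0 <= i < n) coin_content (F i) =
  coin_content (\big[setU/set0]_(i < n) F i).
Proof.
move=> mF tF; elim: n => [|n IHn].
  by rewrite big_nil big_ord0 coin_content0.
rewrite big_nat_recr//= IHn big_ord_recr/= coin_contentU//.
  exact: cylinder_set_bigU.
rewrite -bigcup_mkord -subset0 => x [[i /= lt_in Fix] Fnx].
have in_eq : i = n by apply: tF => //; exists x.
by rewrite in_eq ltnn in lt_in.
Qed.

Lemma coin_content_semi_sigma_additive :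
  semi_sigma_additive (coin_content : set cylinder_space -> \bar R).
Proof.
move=> F mF tF mUF.
have oF i : setT i -> open (F i : set cantor_space).
  by move=> _; apply: open_cylinder_set; exact: mF.
have cU : compact (\bigcup_i F i : set cantor_space).
  apply: (subclosed_compact _ cantor_space_compact) => //.
  rewrite -[X in closed X]setCK; apply: open_closedC.
  by apply: open_cylinder_set; exact: cylinder_setC.
move: cU; rewrite compact_cover => /(_ _ setT _ oF (@subset_refl _ _)).
move=> [D _ UD].
pose N := (\max_(i <- D) i.+1)%N.
apply: cvg_near_cst; exists N => // n /= Nn.
rewrite coin_content_sum//; congr coin_content.
apply/seteqP; split=> x; first by rewrite -bigcup_mkord => -[i _ Fi]; exists i.
move=> /UD[i /= iD Fi]; rewrite -bigcup_mkord; exists i => //=.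
apply: leq_trans Nn; exact: (@leq_bigmax_seq _ _ predT (fun i => i.+1)).
Qed.

HB.instance Definition _ := isMeasure.Build _ cylinder_space R coin_content
  coin_content0 coin_content_ge0 coin_content_semi_sigma_additive.

End coin_content.

(* Caratheodory extension of [coin_content] to the sigma-algebra generated by
   the cylinder sets, which is the Borel sigma-algebra of [cantor_space] *)
Definition fair_coin (R : realType) : set cantor_measurableType -> \bar R :=
  measure_extension (@coin_content R : set cylinder_space -> \bar R).

HB.instance Definition _ (R : realType) := Measure.on (@fair_coin R).

Lemma fair_coin_cylinder (R : realType) (s : seq bool) :
  fair_coin R (cylinder s) = (2 ^- size s)%:E.
Proof.
rewrite /fair_coin /measure_extension measurable_mu_extE/=; last first.
  by exists (size s); exact: determined_cylinder.
rewrite (coin_contentE (@determined_cylinder s)) /cylinder_density.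
rewrite /cylinder_count (_ : [set _ | _]%SET = [set in_tuple s]%SET).
  by rewrite cards1 mul1r.
apply/setP => t; rewrite !inE; apply/asboolP/eqP => [ts|-> //].
apply: val_inj => /=.
have := ts _ (cylinder_pad t); have := cylinder_pad t.
by rewrite /cylinder/= size_tuple => -> ->.
Qed.

Lemma fair_coin_setT (R : realType) : fair_coin R setT = 1%E.
Proof.
rewrite (_ : setT = cylinder [::]); last by apply/seteqP; split.
by rewrite fair_coin_cylinder expr0 invr1.
Qed.

HB.instance Definition _ (R : realType) :=
  Measure_isProbability.Build _ _ R (@fair_coin R) (@fair_coin_setT R).

Definition Gdelta_sigma (T : topologicalType) (B : set T) :=
  exists2 F : (set T)^nat, (forall i, Gdelta (F i)) & B = \bigcup_i F i.

Definition martingale (R : realType) (f : seq bool -> R) :=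
  (forall s, 0 <= f s <= 1) /\
  (forall s, f s = (f (rcons s false) + f (rcons s true)) / 2).

(* Taken in the extended reals so that no boundedness condition is needed; for
   a martingale, whose values lie in [0, 1], this is the real inf-sup. *)
Definition osc (R : realType) (f : seq bool -> R) (beta : cantor_space) : \bar R :=
  ereal_inf [set ereal_sup [set `|f (restr beta p) - f (restr beta q)|%:E
                             | p in [set p | (N <= p)%N] & q in [set q | (N <= q)%N]]
            | N in [set: nat]].

Definition divergence_set (R : realType) (f : seq bool -> R) : set cantor_space :=
  [set beta | (0 < osc f beta)%E].

(* Main.v *)
(* If [f] is a martingale, the increments [f (beta|n) - f (beta|N)] are small in
   L^2 uniformly in [n] for a suitable [N]; Doob's maximal inequality then shows
   that [D(f)] is null, and the definition of oscillation that it is a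
   countable union of G_delta sets.

   Conversely, consider first a null G_delta set [G = bigcap_k F k].  For a
   clopen set [A] of tiny measure, averaging over [d < D] the probabilities that
   the density of [A] ever reaches [2^-d] gives a martingale which starts below
   [2/D], equals 1 on [A], and along a branch never decreases by more than
   [2/D].  Covering [G] by such sets [A_i] with [sum_i 1/D_i] finite and adding
   up, one gets a small martingale [h] that reaches 1 along every branch in [G],
   and converges along every branch on which it stays below 1, by dominated
   convergence of the series.  Now alternate: wait until the branch enters
   [F k], then follow such an [h] upwards or downwards until it reaches 1, then
   pass to [k + 1].  Off [G] this stops after finitely many rounds and the
   martingale converges, on [G] it makes infinitely many jumps of size at least
   1/16.  For [B = bigcup_i G_i] the martingale [sum_i 64^-(i+1) f_i] works: at a
   point of [B] the first divergent term dominates the oscillation of the later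
   ones. *)

Require Import Defs.
From mathcomp Require Import all_boot all_order all_algebra.
From mathcomp Require Import all_classical all_reals all_analysis.
From mathcomp Require Import borel_hierarchy ring lra.

Local Open Scope classical_set_scope.

Section divergence_sets.
Import Order.TTheory GRing.Theory Num.Theory numFieldNormedType.Exports.
Local Open Scope ring_scope.
Set Implicit Arguments.
Unset Strict Implicit.
Context {R : realType}.
Implicit Types (f g : seq bool -> R) (s t : seq bool) (beta : cantor_space).

(** * Conditional expectations on binary strings *)

(** Averaging over one more bit: [iter n step g s] is the conditional expectation, given [s], of [g]
    at length [size s + n]. *)
Definition step g : seq bool -> R :=
  fun s => (g (rcons s false) + g (rcons s true)) / 2.

Lemma iter_stepS n g s : iter n.+1 step g s =
  (iter n step g (rcons s false) + iter n step g (rcons s true)) / 2.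
Proof. by []. Qed.

Lemma iter_step_le n g g' s :
  (forall t, size t = (size s + n)%N -> g t <= g' t) ->
  iter n step g s <= iter n step g' s.
Proof.
elim: n s => [|n IHn] s gg'; first by apply: gg'; rewrite addn0.
rewrite !iter_stepS ler_pM2r ?invr_gt0//.
by apply: lerD; apply: IHn => t tn; apply: gg'; rewrite tn size_rcons addnS.
Qed.

Lemma iter_step_eq n g g' s :
  (forall t, size t = (size s + n)%N -> g t = g' t) ->
  iter n step g s = iter n step g' s.
Proof.
by move=> gg'; apply/eqP; rewrite eq_le !iter_step_le// => t /gg' ->.
Qed.

Lemma iter_step_martingale n g : (forall s, g s = step g s) ->
  forall s, iter n step g s = g s.
Proof.
by move=> mg; elim: n => // n IHn s; rewrite iter_stepS !IHn [RHS]mg.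
Qed.

Lemma iter_step_cst n c s : iter n step (fun=> c) s = c.
Proof. by apply: iter_step_martingale => t; rewrite /step; lra. Qed.

Lemma iter_stepB n g g' s :
  iter n step (fun t => g t - g' t) s = iter n step g s - iter n step g' s.
Proof.
by elim: n s => // n IHn s; rewrite !iter_stepS !IHn; lra.
Qed.

Lemma iter_step_submartingale n g : (forall s, g s <= step g s) ->
  forall s, g s <= iter n step g s.
Proof.
move=> sg; elim: n => // n IHn s; rewrite iter_stepS.
apply: le_trans (sg s) _; rewrite ler_pM2r ?invr_gt0//.
exact: lerD.
Qed.

Lemma martingale_rcons_le g : (forall s, 0 <= g s) ->
  (forall s, g s = step g s) -> forall s b, g (rcons s b) <= 2 * g s.
Proof.
move=> g0 mg s b; rewrite [g s]mg /step.
by have := g0 (rcons s true); have := g0 (rcons s false); case: b; lra.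
Qed.

Lemma martingale_growth g : (forall s, 0 <= g s) ->
  (forall s, g s = step g s) -> forall s, g s <= 2 ^+ size s * g [::].
Proof.
move=> g0 mg; elim/last_ind => [|s b IHs]; first by rewrite mul1r.
apply: le_trans (martingale_rcons_le g0 mg s b) _.
by rewrite size_rcons exprS -mulrA ler_pM2l.
Qed.

Definition constant_from n g := forall s b, (n <= size s)%N -> g (rcons s b) = g s.

Lemma constant_from_restr n g beta m : constant_from n g -> (n <= m)%N ->
  g (restr beta m) = g (restr beta n).
Proof.
move=> cg /subnK <-; elim: (m - n)%N => // k IHk.
by rewrite addSn restrS cg ?size_restr ?leq_addl.
Qed.

Lemma constant_from_iterE n k g s : constant_from n g -> (n <= size s)%N ->
  iter k step g s = g s.
Proof.
move=> cg; elim: k s => // k IHk s ns.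
rewrite iter_stepS !IHk ?size_rcons ?leqW// !cg//; lra.
Qed.

Lemma constant_from_iter n k g : constant_from n g ->
  constant_from n (iter k step g).
Proof.
by move=> cg s b ns; rewrite !(constant_from_iterE _ cg) ?cg// size_rcons leqW.
Qed.

(** The averages in [iter n step g] are taken at lengths at least [n], where [step g] equals [g], so
    one more averaging changes nothing. The result is the Doob martingale of the final value of
    [g]. *)
Lemma constant_from_martingale n g : constant_from n g ->
  forall s, iter n step g s = step (iter n step g) s.
Proof.
move=> cg s; rewrite -[RHS]/(iter n.+1 step g s) iterSr.
by apply: iter_step_eq => t ts; rewrite /step !cg ?ts ?leq_addl//; lra.
Qed.

(** * Hitting events and the maximal inequality *)

Definition hit c g s := has (fun k => c <= g (take k s)) (iota 0 (size s).+1).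

Lemma hitP c g s :
  reflect (exists2 k, (k <= size s)%N & c <= g (take k s)) (hit c g s).
Proof.
apply: (iffP hasP) => [[k]|[k]]; rewrite ?mem_iota ?add0n ?ltnS.
  by move=> /andP[_ ks] ?; exists k.
by move=> ks ?; exists k => //; rewrite mem_iota add0n ltnS.
Qed.

Lemma hit_rcons c g s b : hit c g (rcons s b) = hit c g s || (c <= g (rcons s b)).
Proof.
apply/hitP/orP => [[k]|[/hitP[k ks ck]|cs]].
- rewrite size_rcons leq_eqVlt => /predU1P[->|].
    by rewrite -(size_rcons s b) take_size; right.
  rewrite ltnS => ks; rewrite -cats1 takel_cat// => ck.
  by left; apply/hitP; exists k.
- exists k; first by rewrite size_rcons leqW.
  by rewrite -cats1 takel_cat.
- by exists (size s).+1; rewrite ?size_rcons// -(size_rcons s b) take_size.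
Qed.

Lemma hit_self c g s : c <= g s -> hit c g s.
Proof. by move=> cs; apply/hitP; exists (size s); rewrite ?take_size. Qed.

(** The bound is conditional on [s] so that induction on [n] goes through: at a child where [c] is
    reached for the first time, [c] is at most the value of [g] there, hence at most the later mean
    of [g]. *)
Lemma doob_maximal_inequality c g n s : (forall t, 0 <= g t) ->
    (forall t, g t <= step g t) ->
  c * iter n step (fun t => (hit c g t)%:R) s <=
  if hit c g s then c else iter n step g s.
Proof.
move=> g0 sg; elim: n s => [|n IHn] s /=.
  by case: (hit c g s); rewrite ?mulr1// mulr0.
rewrite /step -/step mulrA mulrDr.
have H b : c * iter n step (fun t => (hit c g t)%:R) (rcons s b) <=
    if hit c g s then c else iter n step g (rcons s b).
  apply: le_trans (IHn _) _; rewrite hit_rcons.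
  case: (hit c g s) => //=; case: ifP => // cs.
  exact: le_trans cs (iter_step_submartingale n sg _).
have := H false; have := H true.
case: (hit c g s) => ? ?; lra.
Qed.

(** Turns the counting of strings that defines the measure of a cylinder set into an iterated
    average. *)
Lemma iter_step_count n g :
  (\sum_(t : n.-tuple bool) g t) / 2 ^+ n = iter n step g [::].
Proof.
elim: n g => [|n IHn] g.
  rewrite expr0 divr1 /= (big_pred1 [tuple])// => t.
  exact/esym/eqP/tuple0.
rewrite iterSr -IHn.
pose h (p : bool * n.-tuple bool) : n.+1.-tuple bool := [tuple of rcons p.2 p.1].
have bh : bijective h.
  apply: inj_card_bij.
    by move=> [b s] [c t] /(congr1 val)/= /rcons_inj[] /val_inj -> ->.
  by rewrite card_prod !card_tuple card_bool expnS.
rewrite (reindex h) /=; last exact: onW_bij.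
rewrite -(pair_bigA _ (fun b (s : n.-tuple bool) => g (rcons s b)))/= big_bool.
under [in RHS]eq_bigr do rewrite /step.
by rewrite -mulr_suml big_split/= exprS invfM mulrA addrC.
Qed.

(** * The fair coin measure *)

Lemma restr_nth beta n i : (i < n)%N -> nth false (restr beta n) i = beta i.
Proof. by move=> i_n; rewrite nth_mkseq. Qed.

Lemma take_restr beta k n : (k <= n)%N -> take k (restr beta n) = restr beta k.
Proof. by move=> kn; rewrite /restr /mkseq -map_take take_iota (minn_idPl kn). Qed.

(** Otherwise points outside [A] that agree with [beta] on longer and longer initial segments would
    converge to [beta] coordinatewise, and so enter [A]. *)
Lemma open_restr (A : set cantor_space) beta : open A -> A beta ->
  exists n, [set c | restr c n = restr beta n] `<=` A.
Proof.
move=> oA Ab; apply: contrapT => /forallNP nA.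
have /choice[c Hc] n : exists c, restr c n = restr beta n /\ ~ A c.
  by have /existsNP[c /not_implyP cP] := nA n; exists c.
have : c n @[n --> \oo] --> beta.
  apply/cvg_sup => i B /= [_ [[W oW <-] Wb]] WB.
  exists i.+1 => // n /= i_n; apply: WB => /=.
  by rewrite /proj -(restr_nth (c n) i_n) (Hc n).1 restr_nth.
move=> /(_ A (open_nbhs_nbhs (conj oA Ab)))[n _ /(_ n (leqnn n))].
by have [] := Hc n.
Qed.

Lemma determined_restr n (P : seq bool -> Prop) :
  determined n [set beta | P (restr beta n)].
Proof. by move=> b c /= ->. Qed.

Lemma fair_coin_cylinder_set (A : set cantor_space) : cylinder_set A ->
  fair_coin R A = coin_content A.
Proof.
move=> cA.
exact: (@measurable_mu_extE _ R cylinder_space coin_content A cA).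
Qed.

Lemma fair_coin_determined n (A : set cantor_space) : determined n A ->
  fair_coin R A = (iter n step (fun s => (`[< A (pad s) >])%:R) [::])%:E.
Proof.
move=> dA; rewrite fair_coin_cylinder_set; last first.
  by exists n.
rewrite (coin_contentE dA) /cylinder_density -iter_step_count /cylinder_count.
rewrite -sum1dep_card natr_sum big_mkcond/=; congr (_ / _)%:E.
apply: eq_bigr => t _; rewrite (asbool_equiv_eq (determinedP (size_tuple t) dA)).
by case: asboolP.
Qed.

Lemma restr_pad s : restr (pad s) (size s) = s.
Proof. exact: cylinder_pad. Qed.

Lemma fair_coin_restr n (P : pred (seq bool)) :
  fair_coin R [set beta | P (restr beta n)] =
  (iter n step (fun s => (P s)%:R) [::])%:E.
Proof.
rewrite (@fair_coin_determined n); last first.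
  exact: (@determined_restr n P).
congr _%:E; apply: iter_step_eq => t /= tn.
by rewrite -[n]/(size (@nil bool) + n)%N -tn restr_pad asboolb.
Qed.

(** [fair_coin] is given by an outer measure defined on all sets, so monotonicity holds for
    arbitrary [A] and [B]. *)
Lemma le_fair_coin (A B : set cantor_space) : A `<=` B ->
  (fair_coin R A <= fair_coin R B)%E.
Proof. exact: (@le_mu_ext _ cylinder_space R coin_content). Qed.

Lemma fair_coin_bigcup0 (A : (set cantor_space)^nat) :
  (forall n, fair_coin R (A n) = 0%E) -> fair_coin R (\bigcup_n A n) = 0%E.
Proof.
move=> A0; apply/eqP; rewrite eq_le; apply/andP; split; last first.
  exact: (@measure_ge0 _ _ _ (fair_coin R)).
have := @mu_ext_sigma_subadditive _ cylinder_space R coin_content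
  (measure_ge0 _) A.
by rewrite [X in (_ <= X)%E]eseries0// => n _ _; exact: A0.
Qed.

Lemma fair_coin_bigcup_nondecreasing (A : (set cantor_space)^nat) (e : R) :
  (forall n, cylinder_set (A n)) -> nondecreasing_seq A ->
  (forall n, (fair_coin R (A n) <= e%:E)%E) ->
  (fair_coin R (\bigcup_n A n) <= e%:E)%E.
Proof.
move=> cA ndA Ae.
have mA n : measurable (A n : set cantor_measurableType).
  by apply: sub_gen_smallest; exact: cA.
have := @nondecreasing_cvg_mu _ cantor_measurableType R (fair_coin R) A mA
  (bigcup_measurable (fun n _ => mA n)) ndA.
move=> /cvg_lim <- //; apply: lime_le; last exact: nearW.
apply: ereal_nondecreasing_is_cvgn => m n mn.
by apply: le_fair_coin; apply/subsetPset; exact: ndA.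
Qed.

(** A single cover by cylinder sets of small total measure is grouped into consecutive finite
    blocks, each starting far enough out in the series to meet its own bound [eta i]. *)
Lemma null_cover (B : set cantor_space) (eta : nat -> R) :
  fair_coin R B = 0%E -> (forall i, 0 < eta i) ->
  exists A : (set cantor_space)^nat, [/\ forall i, cylinder_set (A i),
    forall i, (fair_coin R (A i) <= (eta i)%:E)%E & B `<=` \bigcup_i A i].
Proof.
move=> B0 eta0.
have : (fair_coin R B < (eta 0%N)%:E)%E by rewrite B0 lte_fin.
move=> /ereal_inf_lt[_ /= [C [mC BC] <-]] Ceta.
have C0 k : (0 <= coin_content (C k) :> \bar R)%E by exact: measure_ge0.
have /choice[N HN] i : exists N, forall m, (N <= m)%N ->
    (\sum_(m <= k <oo) coin_content (C k) <= (eta i)%:E)%E.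
  have := @nneseries_tail_cvg R _ xpredT (lt_le_trans Ceta (leey _)) (fun k _ => C0 k).
  move=> /fine_cvgP[Fnum] /cvgrPdist_le/(_ _ (eta0 i)) Fle.
  have [N _ HN] := filterI Fnum Fle; exists N => m Nm.
  have [/= fm] := HN m Nm; rewrite sub0r normrN => le.
  by rewrite -(fineK fm) lee_fin (le_trans (ler_norm _)).
(* For [i > 0] the cut is at least [N i], so the sum from [cut i] on is at most [eta i]; for [i = 0]
   the whole sum is below [eta 0]. Strict growth makes the blocks exhaust the cover. *)
pose fix cut i := if i is j.+1 then maxn (cut j).+1 (N i) else 0%N.
have cut_ge i : (i <= cut i)%N.
  by elim: i => //= i IHi; rewrite leq_max ltnS IHi.
pose A i : set cantor_space := \big[setU/set0]_(cut i <= k < cut i.+1) C k.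
have AE i : A i = \bigcup_(k in [set k | (cut i <= k < cut i.+1)%N]) C k.
  by rewrite /A -bigcup_seq; apply: eq_bigcupl; split=> k /=; rewrite mem_index_iota.
have cA i : cylinder_set (A i).
  by apply: big_ind => [||k _]; [exact: cylinder_set0|exact: cylinder_setU|exact: mC].
exists A; split => // [i|b /BC[k _ Ckb]].
  rewrite fair_coin_cylinder_set//.
  apply: (@le_trans _ _ (\sum_(cut i <= k <oo) coin_content (C k))%E).
    apply: (@measure_sigma_subadditive_tail _ R cylinder_space coin_content) => //.
      exact: cA.
    rewrite AE => b [k /= /andP[ik _] Ckb]; exists k => //=.
    by apply/negP; rewrite -leqNgt.
  case: i => [|i]; first exact: ltW.
  by apply: HN; rewrite /= leq_maxr.
have ex : exists i, (k < cut i.+1)%N by exists k; exact: cut_ge.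
case: (ex_minnP ex) => i ki imin; exists i => //.
rewrite AE; exists k => //=; rewrite ki andbT.
case: i imin {ki} => // i imin; rewrite leqNgt; apply/negP => /imin.
by rewrite ltnn.
Qed.

(** * Series of martingales *)

Section series_nonneg.
Variables (u : nat -> R) (C : R).
Hypotheses (u0 : forall i, 0 <= u i) (uC : forall n, series u n <= C).

Let nd_series : nondecreasing_seq (series u).
Proof. by apply: nondecreasing_series => i _ _; exact: u0. Qed.

Lemma bounded_series_cvg : cvgn (series u).
Proof.
by apply: nondecreasing_is_cvgn => //; exists C => _ [n _ <-]; exact: uC.
Qed.

Lemma series_le_lim n : series u n <= limn (series u).
Proof. exact: (nondecreasing_cvgn_le nd_series bounded_series_cvg). Qed.

Lemma lim_series_le_tail N B :
  (forall n, (N <= n)%N -> series u n - series u N <= B) ->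
  limn (series u) <= series u N + B.
Proof.
move=> tB; apply: limr_le; first exact: bounded_series_cvg.
by exists N => // n /= Nn; rewrite -lerBlDl tB.
Qed.

Lemma lim_series_le : limn (series u) <= C.
Proof. by apply: limr_le; [exact: bounded_series_cvg|exact: nearW]. Qed.

Lemma series_small_tail e : 0 < e ->
  exists N, forall n, (N <= n)%N -> series u n - series u N <= e.
Proof.
move=> e0; have [N _ HN] := (cvgrPdist_le _ _).1 bounded_series_cvg _ e0.
exists N => n Nn; apply: le_trans (HN N (leqnn N)).
by apply: le_trans (ler_norm _); rewrite lerD2r; exact: series_le_lim.
Qed.

End series_nonneg.

Lemma series_le_diff (u v : nat -> R) N n : (forall i, u i <= v i) -> (N <= n)%N ->
  series u n - series u N <= series v n - series v N.
Proof. by move=> uv Nn; rewrite !sub_series_geq//; exact: ler_sum. Qed.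

Lemma series_le (u v : nat -> R) n : (forall i, u i <= v i) ->
  series u n <= series v n.
Proof. by move=> uv; exact: ler_sum. Qed.

(** The bound [C] may depend on the string, since a nonnegative martingale can double at each
    bit. *)
Lemma lim_series_martingale (u : nat -> seq bool -> R) (C : seq bool -> R) :
  (forall i s, 0 <= u i s) -> (forall i s, u i s = step (u i) s) ->
  (forall s n, series (u^~ s) n <= C s) ->
  forall s, limn (series (u^~ s)) = step (fun t => limn (series (u^~ t))) s.
Proof.
move=> u0 mu uC s; have cu t := bounded_series_cvg (u0^~ t) (uC t).
apply/cvg_lim => //; rewrite /step.
rewrite (_ : series (u^~ s) = (fun n => (series (u^~ (rcons s false)) n +
    series (u^~ (rcons s true)) n) / 2)); last first.
  apply/funext => n; rewrite /series/= -big_split/= mulr_suml.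
  by apply: eq_bigr => i _; rewrite mu.
by apply: cvgMr_tmp; apply: cvgD; exact: cu.
Qed.

(** Dominated convergence for series: finitely many terms converge together, and the tail of [b]
    bounds the remaining ones uniformly in [m]. *)
Lemma tannery (u : nat -> nat -> R) (b : nat -> R) (C : R) :
  (forall i m, 0 <= u i m <= b i) -> (forall n, series b n <= C) ->
  (forall i, cvgn (u i)) -> cvgn (fun m => limn (series (u^~ m))).
Proof.
move=> ub bC cu; pose l i := limn (u i).
have u0 i m : 0 <= u i m by have /andP[] := ub i m.
have ule i m : u i m <= b i by have /andP[] := ub i m.
have b0 i : 0 <= b i by exact: le_trans (u0 i 0%N) (ule i 0%N).
have l0 i : 0 <= l i by apply: limr_ge; [exact: cu|exact: nearW].
have lle i : l i <= b i by apply: limr_le; [exact: cu|exact: nearW].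
have uC m n : series (u^~ m) n <= C by apply: le_trans (bC n); exact: series_le.
have lC n : series l n <= C by apply: le_trans (bC n); exact: series_le.
apply/cvg_ex; exists (limn (series l)); apply/cvgrPdist_le => e e0.
have e2 : 0 < e / 2 by rewrite divr_gt0.
have [N HN] := series_small_tail b0 bC e2.
have cN : series (u^~ m) N @[m --> \oo] --> series l N.
  by apply: cvg_big => [|i _]; [exact: add_continuous|exact: cu].
have [m0 _ Hm] := (cvgrPdist_le _ _).1 cN _ e2.
exists m0 => // m /= /Hm; rewrite /= !ler_norml => /andP[d1 d2].
have lt := lim_series_le_tail l0 lC
  (fun n Nn => le_trans (series_le_diff lle Nn) (HN n Nn)).
have ut := lim_series_le_tail (u0^~ m) (uC m)
  (fun n Nn => le_trans (series_le_diff (ule^~ m) Nn) (HN n Nn)).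
have := series_le_lim l0 lC N; have := series_le_lim (u0^~ m) (uC m) N.
by move=> ? ?; apply/andP; split; lra.
Qed.

(* The function is the average over [d < D] of the conditional probabilities
   that the density of [A] ever reaches [2 ^- d], a discrete version of
   [1 + log_2 (M 1_A) / D] where [M] is the maximal function: taking the
   logarithm makes it nearly monotone along every branch. *)
Lemma spike_martingale (A : set cantor_space) n D : determined n A -> (0 < D)%N ->
  exists h : seq bool -> R,
    [/\ forall s, 0 <= h s, forall s, h s = step h s, constant_from n h,
        forall beta, A beta -> 1 <= h (restr beta n) &
        (forall beta m m', (m <= m')%N ->
           h (restr beta m) <= h (restr beta m') + 2 / D%:R) /\
        forall s (p : R), (fair_coin R A <= p%:E)%E ->
          2 ^+ size s * p < 2 ^- D -> h s <= 2 / D%:R].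
Proof.
move=> dA D0.
pose chi s : R := (`[< A (pad s) >])%:R.
(* [M s] is the density of [A] in the cylinder of [s]. *)
pose M := iter n step chi.
have chic : constant_from n chi.
  move=> s b ns; congr ((nat_of_bool _)%:R); apply: asbool_equiv_eq.
  have E : restr (pad (rcons s b)) n = restr (pad s) n.
    rewrite -(take_restr (pad s) ns) restr_pad.
    rewrite -(@take_restr _ n (size (rcons s b))) ?size_rcons ?leqW//.
    by rewrite -(size_rcons s b) restr_pad -cats1 takel_cat.
  by split; apply: dA.
have Mm s : M s = step M s by exact: constant_from_martingale.
have M0 s : 0 <= M s.
  rewrite -(iter_step_cst n (0 : R) s); apply: iter_step_le => t _.
  exact: ler0n.
have Mc : constant_from n M by exact: constant_from_iter.
pose hitR d s : R := (hit (2 ^- d) M s)%:R.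
have hitc d : constant_from n (hitR d).
  move=> s b ns; rewrite /hitR hit_rcons; rewrite Mc//.
  by case: (boolP (2 ^- d <= M s)) => [/hit_self ->//|_]; rewrite orbF.
pose H d := iter n step (hitR d).
have Hm d s : H d s = step (H d) s by exact: constant_from_martingale.
have hit_step d s : hitR d s <= step (hitR d) s.
  have K b : hitR d s <= hitR d (rcons s b).
    by rewrite /hitR ler_nat hit_rcons; case: (hit _ _ s).
  by rewrite /step; have := K false; have := K true; lra.
have hitH d s : hitR d s <= H d s by exact: iter_step_submartingale.
have H1 d s : H d s <= 1.
  rewrite -(iter_step_cst n 1 s); apply: iter_step_le => t _.
  by rewrite /hitR; case: hit.
have HM d s : ~~ hit (2 ^- d) M s -> H d s <= 2 ^+ d * M s.
  move=> nh; rewrite -ler_pdivrMl ?exprn_gt0// -(iter_step_martingale n Mm s).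
  have /(_ n s) := @doob_maximal_inequality (2 ^- d) M _ _ M0.
  by rewrite (negbTE nh); apply => t; rewrite -Mm.
(* A level already reached adds 1 to the right side and at most 1 to the left. An unreached level
   [d] adds at most [2 ^+ d * M s < 1]; the second bound sums these geometrically, and at an
   unreached level it yields the constant 2 of the first. *)
have gap d s : \sum_(i < d) H i s <= \sum_(i < d) hitR i s + 2 /\
               \sum_(i < d) H i s <= \sum_(i < d) hitR i s + 2 ^+ d * M s.
  elim: d => [|d [IH1 IH2]].
    by rewrite !big_ord0 expr0 mul1r !add0r; split.
  have Md : 0 <= 2 ^+ d * M s by rewrite mulr_ge0 ?exprn_ge0.
  rewrite !big_ord_recr /= exprS -mulrA.
  have [hd|nhd] := boolP (hit (2 ^- d) M s).
    have -> : hitR d s = 1 by rewrite /hitR hd.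
    by have := H1 d s; split; lra.
  have -> : hitR d s = 0 by rewrite /hitR (negbTE nhd).
  have Mlt : 2 ^+ d * M s < 1.
    rewrite mulrC -ltr_pdivlMr ?exprn_gt0// div1r ltNge.
    by apply: contra nhd; exact: hit_self.
  by have := HM _ _ nhd; split; lra.
pose h s := (\sum_(d < D) H d s) / D%:R.
(* [psi] is nondecreasing along branches and [psi <= h <= psi + 2 / D], so [h] never drops by more
   than [2 / D]. *)
pose psi s := (\sum_(d < D) hitR d s) / D%:R.
have DR : 0 < D%:R :> R by rewrite ltr0n.
have psih s : psi s <= h s.
  by rewrite ler_pM2r ?invr_gt0//; apply: ler_sum => d _; exact: hitH.
have hpsi s : h s <= psi s + 2 / D%:R.
  by rewrite -mulrDl ler_pM2r ?invr_gt0//; exact: (gap D s).1.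
exists h; split => [s|s|s b ns|beta Ab|].
- apply: le_trans (psih s); apply: divr_ge0 => //.
  by apply: sumr_ge0 => d _; exact: ler0n.
- rewrite /h /step -mulrDl mulrAC -big_split/=; congr (_ / _).
  by rewrite mulr_suml; apply: eq_bigr => d _; rewrite Hm.
- by rewrite /h; congr (_ / _); apply: eq_bigr => d _; exact: constant_from_iter.
- apply: le_trans (psih _); rewrite ler_pdivlMr// mul1r.
  have -> : D%:R = \sum_(d < D) (1 : R) by rewrite sumr_const card_ord.
  apply: ler_sum => d _; rewrite /hitR ler1n lt0b; apply: hit_self.
  rewrite /M (constant_from_iterE _ chic) ?size_restr// /chi asboolT.
    by rewrite invf_le1 ?exprn_gt0// exprn_ege1// ler1n.
  by apply: dA Ab; have := restr_pad (restr beta n); rewrite size_restr => ->.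
split=> [beta m m' mm'|s p Ap sp].
  apply: le_trans (hpsi _) _; rewrite lerD2r; apply: le_trans (psih _).
  rewrite ler_pM2r ?invr_gt0//; apply: ler_sum => d _; rewrite /hitR ler_nat.
  move/subnK: mm' => <-; elim: (m' - m)%N => // k /leq_trans; apply.
  by rewrite addSn restrS hit_rcons; case: (hit _ _ _).
(* At most doubling with each bit, the density stays below [2 ^- D] on all prefixes of [s]; no level
   is reached and [psi s] vanishes. *)
apply: le_trans (hpsi s) _; rewrite gerDr pmulr_lle0 ?invr_gt0//.
rewrite big1// => d _; rewrite /hitR; case: hitP => // -[k ks dk].
exfalso; move: sp; apply/negP; rewrite -leNgt.
apply: (@le_trans _ _ (2 ^- d)).
  by rewrite lef_pV2 ?posrE ?exprn_gt0// ler_eXn2l ?ltr1n// ltnW.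
apply: le_trans dk _; apply: le_trans (martingale_growth M0 Mm _) _.
have Mp : M [::] <= p by rewrite -lee_fin -(fair_coin_determined dA).
apply: (@le_trans _ _ (2 ^+ size s * M [::])); last by rewrite ler_pM2l ?exprn_gt0.
by rewrite ler_wpM2r// ler_eXn2l ?ltr1n// size_take_min geq_minr.
Qed.

(** * Small martingales reaching 1 on a null set *)

Lemma constant_from_cvg n g beta : constant_from n g ->
  cvgn (fun m => g (restr beta m)).
Proof.
move=> cg; apply/cvg_ex; exists (g (restr beta n)); apply: cvg_near_cst.
by exists n => // m /= nm; exact: constant_from_restr.
Qed.

(** The bound 1/2 up to length [N] ensures that, started at length [N], [h] has to rise by at least
    1/2 before it reaches 1. *)
Lemma null_martingale (B : set cantor_space) N : fair_coin R B = 0%E ->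
  exists h : seq bool -> R,
    [/\ forall s, 0 <= h s, forall s, h s = step h s,
        forall s, (size s <= N)%N -> h s <= 1 / 2,
        forall beta, B beta -> exists m, 1 <= h (restr beta m) &
        forall beta, (forall m, h (restr beta m) < 1) ->
          cvgn (fun m => h (restr beta m))].
Proof.
(* This choice gives [w i = 2 ^- i.+2], with sum 1/2, which bounds both the sum at lengths up to [N]
   and the total drop along a branch. *)
move=> B0; pose D i := (2 ^ i.+3)%N; pose w i : R := 2 / (D i)%:R.
have [A [cA Aeta BA]] :
    exists A : (set cantor_space)^nat, [/\ forall i, cylinder_set (A i),
    forall i, (fair_coin R (A i) <= (2 ^- (D i + N.+1))%:E)%E & B `<=` \bigcup_i A i].
  (* Strings of length at most [N] raise the density by a factor at most [2 ^+ N]; the extra factor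
     1/2 makes the bound [2 ^- D i] strict. *)
  by apply: (null_cover (eta := fun i => 2 ^- (D i + N.+1))).
have [n dA] := choice cA.
have D0 i : (0 < D i)%N by rewrite expn_gt0.
have [u Hu] := choice (fun i => @spike_martingale _ _ _ (dA i) (D0 i)).
have u0 i s : 0 <= u i s by have [] := Hu i.
have um i s : u i s = step (u i) s by have [] := Hu i.
have uc i : constant_from (n i) (u i) by have [] := Hu i.
have uA i beta : A i beta -> 1 <= u i (restr beta (n i)).
  by have [_ _ _ H _] := Hu i; exact: H.
have u_almost i beta m m' : (m <= m')%N ->
    u i (restr beta m) <= u i (restr beta m') + w i.
  by have [_ _ _ _ [H _]] := Hu i; exact: H.
have usmall i s : (size s <= N)%N -> u i s <= w i.
  move=> sN; have [_ _ _ _ [_ H]] := Hu i; apply: H (Aeta i) _.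
  rewrite exprD invfM mulrCA gtr_pMr ?invr_gt0 ?exprn_gt0//.
  by rewrite ltr_pdivrMr ?exprn_gt0// mul1r ltr_eXn2l ?ltr1n// ltnS.
have w0 i : 0 <= w i by rewrite divr_ge0.
have wE k : series w k = 1 / 2 - 1 / 2 ^+ k.+1.
  elim: k => [|k IHk]; first by rewrite /series/= big_nil expr1 subrr.
  rewrite seriesS IHk /w /D natrX !exprS.
  have /lt0r_neq0 : (0 : R) < 2 ^+ k by rewrite exprn_gt0.
  by move=> ?; field.
have wC k : series w k <= 1 / 2.
  by rewrite wE gerBl divr_ge0// exprn_ge0.
have uC s k : series (u^~ s) k <= 2 ^+ size s * (1 / 2).
  apply: (@le_trans _ _ (series (fun i => 2 ^+ size s * w i) k)).
    apply: series_le => i; apply: le_trans (martingale_growth (u0 i) (um i) s) _.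
    by rewrite ler_pM2l ?exprn_gt0// usmall.
  by rewrite /series/= -mulr_sumr ler_pM2l ?exprn_gt0//; exact: wC.
pose h s := limn (series (u^~ s)).
have uh s k : series (u^~ s) k <= h s by exact: (series_le_lim (u0^~ s) (uC s)).
have uih s i : u i s <= h s.
  apply: le_trans (uh s i.+1); rewrite seriesS lerDl.
  by apply: sumr_ge0 => j _; exact: u0.
exists h; split.
- by move=> s; apply: le_trans (uh s 0%N); rewrite /series/= big_nil.
- exact: lim_series_martingale um uC.
- move=> s sN; apply: (lim_series_le (u0^~ s)) => k.
  by apply: le_trans (wC k); apply: series_le => i; exact: usmall.
- move=> beta /BA[i _ Aib]; exists (n i); apply: le_trans (uih _ i).
  exact: uA.
(* Each [u i] is nearly nondecreasing along [beta], hence dominated by its final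
   value plus [w i]; these bounds are summable because [h] stays below 1. *)
move=> beta h1; pose b i := u i (restr beta (n i)) + w i.
apply: (@tannery (fun i m => u i (restr beta m)) b (1 + 1 / 2)).
- move=> i m; rewrite u0/=; apply: le_trans (u_almost i beta _ _ (leq_maxl m (n i))) _.
  by rewrite lerD2r (constant_from_restr _ (uc i)) ?leq_maxr.
- move=> k; rewrite /b /series/= big_split/=; apply: lerD; last exact: wC.
  (* At length [m] the first [k] summands all have their final values, so their sum is bounded by a
     single value of [h], which is below 1. *)
  pose m := (\max_(i < k) n i)%N.
  apply: le_trans (ltW (h1 m)); apply: le_trans (uh _ k).
  rewrite /series/= !big_mkord; apply: ler_sum => i _.
  by rewrite (@constant_from_restr (n i) _ _ m)// /m leq_bigmax.
- by move=> i; exact: constant_from_cvg (uc i).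
Qed.

(** * Divergence sets are null and G_delta-sigma *)

Lemma divergence_setP f beta : divergence_set f beta <->
  exists2 e : R, 0 < e & forall N, exists p q, [/\ (N <= p)%N, (N <= q)%N &
    e < `|f (restr beta p) - f (restr beta q)|].
Proof.
split=> [osc_gt0|[e e0 He]].
  have [e e0 eosc] : exists2 e : R, 0 < e & (e%:E < osc f beta)%E.
    move: osc_gt0; rewrite /divergence_set /=; case: (osc f beta) => [r||]//.
      rewrite lte_fin => r0; exists (r / 2); first by rewrite divr_gt0.
      by rewrite lte_fin ltr_pdivrMr// ltr_pMr// ltr1n.
    by exists 1 => //; rewrite ltey.
  exists e => // N.
  have : (e%:E < ereal_sup [set `|f (restr beta p) - f (restr beta q)|%:E
      | p in [set p | (N <= p)%N] & q in [set q | (N <= q)%N]])%E.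
    by apply: lt_le_trans eosc _; apply: ereal_inf_lbound; exists N.
  move=> /ereal_sup_gt[_ /= [p Np [q Nq <-]]]; rewrite lte_fin => epq.
  by exists p, q.
apply: (@lt_le_trans _ _ e%:E); first by rewrite lte_fin.
apply: le_ereal_inf_tmp => _ /= [N _ <-]; have [p [q [Np Nq epq]]] := He N.
apply: (@le_trans _ _ `|f (restr beta p) - f (restr beta q)|%:E).
  by rewrite lee_fin ltW.
by apply: ereal_sup_ubound; exists p => //; exists q.
Qed.

Lemma divergence_setE f beta :
  divergence_set f beta <-> ~ cvgn (fun n => f (restr beta n)).
Proof.
rewrite divergence_setP; split=> [[e e0 He] cf|ncf].
  have e2 : 0 < e / 2 by rewrite divr_gt0.
  have [N _ HN] := (cvgrPdist_lt _ _).1 cf _ e2.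
  have [p [q [/HN/= Np /HN/= Nq]]] := He N.
  apply/negP; rewrite -leNgt; move: Np Nq; set l := limn _ => Np Nq.
  rewrite (_ : _ - _ = (l - f (restr beta q)) - (l - f (restr beta p))); last ring.
  by apply: le_trans (ler_normB _ _) _; lra.
apply: contrapT => /forallPNP nosc; apply: ncf.
apply/cauchy_cvgP/cauchy_exP => e e0.
have e2 : 0 < e / 2 by rewrite divr_gt0.
have /existsNP[N HN] := nosc _ e2.
exists (f (restr beta N)), N => // n /= Nn.
rewrite /ball/= ltNge; apply/negP => en; apply: HN; exists N, n; split=> //.
by apply: lt_le_trans en; rewrite ltr_pdivrMr// ltr_pMr// ltr1n.
Qed.

(** The threshold can be taken of the form [k.+1%:R^-1]. For fixed [k], [p], [q] the condition
    depends on finitely many bits, hence is open, and only the quantifier over [N] requires an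
    intersection. *)
Lemma divergence_set_Gdelta_sigma f : Gdelta_sigma (divergence_set f).
Proof.
pose O k p q := [set beta : cantor_space |
  k.+1%:R^-1 < `|f (restr beta p) - f (restr beta q)|].
exists (fun k => \bigcap_N \bigcup_(p in [set p | (N <= p)%N])
    \bigcup_(q in [set q | (N <= q)%N]) O k p q).
  move=> k; eexists; last by reflexivity.
  move=> N; apply: bigcup_open => p _; apply: bigcup_open => q _.
  apply: open_cylinder_set; exists (maxn p q) => b c E.
  by rewrite /O/= (restr_le (leq_maxl p q) E) (restr_le (leq_maxr p q) E).
apply/seteqP; split=> beta.
  move=> /divergence_setP[e e0 He].
  have [k _ /(_ k (leqnn k)) ke] := near_infty_natSinv_lt (PosNum e0).
  exists k => // N _; have [p [q [Np Nq epq]]] := He N.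
  by exists p => //; exists q => //; exact: lt_trans ke epq.
move=> [k _ Hk]; apply/divergence_setP; exists k.+1%:R^-1 => // N.
by have [p Np [q Nq Opq]] := Hk N I; exists p, q.
Qed.

(** Up to length [N] the increment is 0. Beyond it, both children share the prefix of length [N],
    and the defect is the square of half the difference of [f] at the children. *)
Lemma squared_increment_submartingale f N : (forall s, f s = step f s) ->
  let phi s := (f s - f (take N s)) ^+ 2 in forall s, phi s <= step phi s.
Proof.
move=> mf phi s; rewrite /phi /step.
have [Ns|sN] := leqP N (size s).
  rewrite -!cats1 !takel_cat// !cats1 (mf s) /step -subr_ge0.
  set a := f _; set b := f (rcons _ _); set d := f _.
  rewrite (_ : _ - _ = ((a - b) / 2) ^+ 2) ?sqr_ge0//; by field.
rewrite !take_oversize ?size_rcons// 1?ltnW// !subrr; lra.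
Qed.

(** Martingale increments are orthogonal, so the mean of the squared increment from [N] to [N + n]
    is [E (N + n) - E N], where [E] is nondecreasing and bounded by 1. *)
Lemma martingale_L2_cauchy f : martingale f -> forall e, 0 < e ->
  exists N, forall n,
    iter n step (fun s => (f s - f (take N s)) ^+ 2) [::] <= e.
Proof.
move=> [f01 mf] e e0.
have {}mf s : f s = step f s by exact: mf.
pose f2 s := f s ^+ 2.
have f2sub s : f2 s <= step f2 s.
  rewrite /f2 /step mf /step -subr_ge0.
  set a := f _; set b := f _.
  rewrite (_ : _ - _ = ((a - b) / 2) ^+ 2) ?sqr_ge0//; by field.
pose E n := iter n step f2 [::].
have ndE : nondecreasing_seq E.
  move=> m n mn; rewrite -(subnKC mn) /E iterD; apply: iter_step_le => t _.
  exact: iter_step_submartingale.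
have E1 n : E n <= 1.
  rewrite -(iter_step_cst n 1 [::]); apply: iter_step_le => t _.
  by have /andP[? ?] := f01 t; rewrite /f2 expr_le1.
have cE : cvgn E by apply: nondecreasing_is_cvgn => //; exists 1 => _ [n _ <-].
have [N _ HN] := (cvgrPdist_le _ _).1 cE _ e0.
exists N => n; set phi := fun s => _.
(* Expanding the square given [s]: the factor [f (take N s)] is already known, and the conditional
   mean of [f] is [f s]. *)
have phiE j s : (N <= size s)%N -> iter j step phi s =
    iter j step f2 s - 2 * f (take N s) * f s + f (take N s) ^+ 2.
  elim: j s => [|j IHj] s Ns; first by rewrite /= /phi /f2; ring.
  rewrite !iter_stepS !IHj ?size_rcons ?leqW// -!cats1 !takel_cat// !cats1.
  by rewrite (mf s) /step; field.
have phisub := squared_increment_submartingale N mf.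
apply: le_trans (HN N (leqnn N)).
apply: (@le_trans _ _ (E (N + n)%N - E N)); last first.
  apply: le_trans (ler_norm _); rewrite lerD2r; exact: nondecreasing_cvgn_le.
rewrite /E iterD -iter_stepB.
(* The submartingale property replaces length [n], possibly below [N], by [N + n]. *)
apply: (@le_trans _ _ (iter (N + n) step phi [::])).
  rewrite addnC iterD; apply: iter_step_le => t _.
  exact: iter_step_submartingale.
rewrite iterD; apply: iter_step_le => t /= tN.
by rewrite phiE ?tN// take_oversize ?tN// /f2 le_eqVlt; apply/orP; left; apply/eqP; ring.
Qed.

Lemma fair_coin_divergence_set f : martingale f ->
  fair_coin R (divergence_set f) = 0%E.
Proof.
move=> mf.
pose F k := [set beta : cantor_space | forall N, exists p q,
  [/\ (N <= p)%N, (N <= q)%N &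
      k.+1%:R^-1 < `|f (restr beta p) - f (restr beta q)|]].
suff F0 k : fair_coin R (F k) = 0%E.
  apply/eqP; rewrite eq_le (@measure_ge0 _ _ _ (fair_coin R)) andbT.
  rewrite -(fair_coin_bigcup0 F0); apply: le_fair_coin => beta.
  move=> /divergence_setP[e e0 He].
  have [k _ /(_ k (leqnn k)) ke] := near_infty_natSinv_lt (PosNum e0).
  exists k => // N; have [p [q [Np Nq epq]]] := He N.
  by exists p, q; split => //; exact: lt_trans ke epq.
apply/eqP; rewrite eq_le (@measure_ge0 _ _ _ (fair_coin R)) andbT.
apply/lee_addgt0Pr => e e0; rewrite add0e.
(* Two values more than [k.+1%:R^-1] apart cannot both lie within half of that of
   [f (restr beta N)]; the square matches [phi]. *)
pose c : R := (k.+1%:R^-1 / 2) ^+ 2.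
have c0 : 0 < c by rewrite exprn_gt0// divr_gt0.
have [N HN] := martingale_L2_cauchy mf (mulr_gt0 c0 e0).
set phi := (fun s => _) in HN.
have phi0 s : 0 <= phi s by exact: sqr_ge0.
have phisub := squared_increment_submartingale N mf.2.
pose A n := [set beta : cantor_space | hit c phi (restr beta n)].
apply: (@le_trans _ _ (fair_coin R (\bigcup_n A n))).
  apply: le_fair_coin => beta /(_ N)[p [q [Np Nq pq]]].
  suff [r Nr rc] : exists2 r, (N <= r)%N & k.+1%:R^-1 / 2 <=
      `|f (restr beta r) - f (restr beta N)|.
    exists r => //; rewrite /A/=; apply: hit_self.
    rewrite /phi take_restr// -[leRHS]real_normK ?num_real//.
    by rewrite lerXn2r ?nnegrE// divr_ge0.
  have [?|pN] := lerP (k.+1%:R^-1 / 2) `|f (restr beta p) - f (restr beta N)|.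
    by exists p.
  exists q => //; rewrite leNgt; apply/negP => qN; move: pq; apply/negP.
  rewrite -leNgt (_ : f _ - _ = (f (restr beta p) - f (restr beta N)) -
    (f (restr beta q) - f (restr beta N))); last ring.
  apply: le_trans (ler_normB _ _) _.
  by rewrite [leRHS]splitr lerD// ltW.
apply: fair_coin_bigcup_nondecreasing => [n|m n mn|n].
- by exists n => b d /= E; rewrite /A/= E.
- apply/subsetPset => beta; rewrite /A/=.
  move/subnK: mn => <-; elim: (n - m)%N => // j IHj /IHj.
  by rewrite addSn restrS hit_rcons => ->.
rewrite fair_coin_restr lee_fin -(ler_pM2l c0); apply: le_trans (HN n).
(* At the empty string [phi] is 0 and [c] is positive, so [c] is not yet hit there. *)
have := doob_maximal_inequality c n [::] phi0 phisub; case: hitP => // -[j _].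
by rewrite /phi !take_oversize// subrr expr0n/= => /le_lt_trans/(_ c0); rewrite ltxx.
Qed.

(** * Martingales diverging on a null set *)

Section phases.

(* [Wait k x]: the martingale stays at [x] until the branch enters [F k].
   [Play k N x]: since length [N], where its value was [x], the martingale has
   followed [h N], upwards or downwards depending on [x], until [h N] reaches 1. *)
Inductive phase := Wait of nat & R | Play of nat & nat & R.

Variables (h : nat -> seq bool -> R) (F : (set cantor_space)^nat).
Hypotheses (h0 : forall N s, 0 <= h N s) (hm : forall N s, h N s = step (h N) s).
Hypothesis hN : forall N s, (size s <= N)%N -> h N s <= 1 / 2.
Hypothesis oF : forall k, open (F k).

(** Each round moves away from the nearer end of the unit interval, which keeps the values at the
    ends of rounds between 1/8 and 7/8. *)
Definition direction (x : R) : R := if x < 1 / 2 then 1 else -1.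

(** On reaching 1, [h N] is below 2, as it was below 1 one bit earlier, and it started from at most
    1/2. The factor 1/8 thus makes the move of a round at least 1/16 and less than 1/4. *)
Definition value (p : phase) t : R :=
  match p with
  | Wait _ x => x
  | Play _ N x => x + direction x * (h N t - h N (take N t)) / 8
  end.

(** A round opened at [t] uses the martingale with index [size t], which is at most 1/2 there. *)
Definition next (p : phase) t : phase :=
  match p with
  | Wait k x => if `[< cylinder t `<=` F k >] then Play k (size t) x else p
  | Play k N _ => if 1 <= h N t then Wait k.+1 (value p t) else p
  end.

Fixpoint run_rev (r : seq bool) : phase :=
  if r is b :: r' then next (run_rev r') (rev r) else Wait 0 (1 / 2).

Definition run s := run_rev (rev s).

Definition phase_martingale s := value (run s) s.

(** Counts the phase changes made so far. *)
Definition phase_rank (p : phase) : nat :=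
  match p with Wait k _ => k.*2 | Play k _ _ => k.*2.+1 end.

Definition phase_inv s (p : phase) : Prop :=
  match p with
  | Wait k x => 1 / 8 <= x <= 7 / 8 /\ forall j, (j < k)%N -> cylinder s `<=` F j
  | Play k N x => [/\ 1 / 8 <= x <= 7 / 8, (N <= size s)%N,
      forall m, h N (take m s) < 1 &
      forall j, (j <= k)%N -> cylinder s `<=` F j]
  end.

Lemma run_rcons s b : run (rcons s b) = next (run s) (rcons s b).
Proof. by rewrite /run rev_rcons /= rev_cons revK. Qed.

(** A change of phase causes no jump, so the martingale identity can be checked inside the old
    phase. *)
Lemma value_next p t : value (next p t) t = value p t.
Proof.
case: p => [k x|k N x] /=; case: ifP => //= _.
by rewrite take_size subrr mulr0 mul0r addr0.
Qed.

Lemma phase_rank_next p t :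
  next p t = p \/ phase_rank (next p t) = (phase_rank p).+1.
Proof. by case: p => [k x|k N x] /=; case: ifP => _ /=; auto. Qed.

Lemma phase_inv_run s : phase_inv s (run s).
Proof.
elim/last_ind: s => [|s b]; first by rewrite /run /=; split => //; lra.
rewrite run_rcons; case: (run s) => [k x|k N x] /=.
  move=> [xb sF]; case: asboolP => [skF|_] /=; last first.
    by split => // j /sF sFj; apply: subset_trans sFj; exact: cylinder_rcons.
  split => // [m|j].
    apply: (@le_lt_trans _ _ (1 / 2)); last lra.
    by apply: hN; rewrite size_take_min geq_minr.
  rewrite leq_eqVlt => /predU1P[->//|/sF sFj].
  by apply: subset_trans sFj; exact: cylinder_rcons.
move=> [xb Ns h1 sF].
have sF' j : (j <= k)%N -> cylinder (rcons s b) `<=` F j.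
  by move=> /sF sFj; apply: subset_trans sFj; exact: cylinder_rcons.
case: ifP => [h1s|/negbT]; last first.
  rewrite -ltNge => h1s; split => //; first by rewrite size_rcons leqW.
  move=> m; have [ms|sm] := leqP m (size s).
    by rewrite -cats1 takel_cat.
  by rewrite take_oversize// size_rcons.
(* The round ends here: from below 1/2 the value rises to less than 3/4, and otherwise it falls to
   more than 1/4. *)
split => //; rewrite -cats1 takel_cat// cats1.
have hs : h N s < 1 by rewrite -(take_size s).
have := martingale_rcons_le (h0 N) (hm N) s b.
have hv : h N (take N s) <= 1 / 2 by apply: hN; rewrite size_take_min geq_minl.
have := h0 N (take N s).
by rewrite /direction; case: ifPn; rewrite -?leNgt; lra.
Qed.

Lemma phase_martingaleP : martingale phase_martingale.
Proof.
split=> s; rewrite /phase_martingale.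
  have := phase_inv_run s; case: (run s) => [k x [xb _]|k N x [xb Ns h1 _]] /=.
    by lra.
  have hs : h N s < 1 by rewrite -(take_size s).
  have hv : h N (take N s) <= 1 / 2 by apply: hN; rewrite size_take_min geq_minl.
  have := h0 N (take N s); have := h0 N s.
  by rewrite /direction; case: ifPn; rewrite -?leNgt; lra.
rewrite !run_rcons !value_next.
have := phase_inv_run s; case: (run s) => [k x _|k N x [_ Ns _ _]] /=.
  by lra.
rewrite -!cats1 !takel_cat// !cats1 (hm N s) /step.
by rewrite /direction; case: ifPn; lra.
Qed.

Lemma run_restrS beta n :
  run (restr beta n.+1) = next (run (restr beta n)) (restr beta n.+1).
Proof. by rewrite restrS run_rcons. Qed.

Lemma phase_martingale_cvg beta :
  (forall N, (forall m, h N (restr beta m) < 1) ->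
     cvgn (fun m => h N (restr beta m))) ->
  ~ (\bigcap_k F k) beta -> cvgn (fun m => phase_martingale (restr beta m)).
Proof.
move=> hcvg nFb; pose st n := run (restr beta n).
(* Reaching high ranks would put [beta] in every [F k], by the cylinder clauses of [phase_inv]. *)
have [K rK] : exists K, forall n, (phase_rank (st n) < K)%N.
  apply: contrapT => /forallNP ub; apply: nFb => k _.
  have /existsNP[n /negP] := ub k.*2.+2; rewrite -leqNgt => kn.
  suff : cylinder (restr beta n) `<=` F k.
    by apply; rewrite /cylinder/= size_restr.
  have := phase_inv_run (restr beta n); rewrite -/(st n).
  move: kn; case: (st n) => [k' x|k' N x] /= kk [] => [_|_ _ _]; apply.
    by rewrite -ltn_double (leq_trans _ kk).
  by rewrite -leq_double -ltnS (leq_trans _ kk).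
(* Lower the bound until it is tight; once the largest rank is attained, a change of phase would
   exceed it. *)
have [n0 Hn0] : exists n0, forall n, (n0 <= n)%N -> st n = st n0.
  elim: K rK => [/(_ 0%N)//|K IHK rK].
  have [[n1 n1K]|noK] := pselect (exists n, phase_rank (st n) = K); last first.
    apply: IHK => n; rewrite ltn_neqAle -ltnS rK andbT.
    by apply/eqP => nK; apply: noK; exists n.
  exists n1 => n /subnK <-; elim: (n - n1)%N => // j IHj.
  rewrite addSn /st run_restrS -/(st _) IHj.
  have [//|rk] := phase_rank_next (st n1) (restr beta (j + n1).+1).
  have := rK (j + n1).+1; rewrite /st run_restrS -/(st _) IHj rk n1K.
  by rewrite ltnn.
have stE n : (n0 <= n)%N ->
    phase_martingale (restr beta n) = value (st n0) (restr beta n).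
  by move=> /Hn0; rewrite /phase_martingale => <-.
have inv n : (n0 <= n)%N -> phase_inv (restr beta n) (st n0).
  by move=> /Hn0 <-; exact: phase_inv_run.
have eqv : {near \oo, (fun n => value (st n0) (restr beta n)) =1
    (fun n => phase_martingale (restr beta n))}.
  by exists n0 => // n /= /stE.
apply/cvg_ex.
suff [l vl] : exists l : R, value (st n0) (restr beta n) @[n --> \oo] --> l.
  by exists l; apply: cvg_trans vl; exact: near_eq_cvg.
move: inv; case: (st n0) => [k x|k N x] /= inv.
  by exists x; exact: cvg_cst.
have h1 m : h N (restr beta m) < 1.
  have [_ _ + _] := inv _ (leq_maxl n0 m) => /(_ m).
  by rewrite take_restr// leq_maxr.
exists (x + direction x *
  (limn (fun m => h N (restr beta m)) - h N (restr beta N)) / 8).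
apply: cvgD; first exact: cvg_cst.
apply: cvgMr_tmp; apply: cvgMl_tmp; apply: cvgB; first exact: hcvg.
apply: cvg_near_cst; exists N => // n /= Nn.
by rewrite take_restr.
Qed.

Lemma wait_ends beta n k x : (\bigcap_k F k) beta ->
  run (restr beta n) = Wait k x ->
  exists2 m, (n < m)%N & run (restr beta m) = Play k m x.
Proof.
move=> Fb runn; apply: contrapT => noP.
have st j : run (restr beta (n + j)) = Wait k x.
  elim: j => [|j IHj]; first by rewrite addn0.
  rewrite addnS run_restrS IHj /=; case: asboolP => // jF.
  exfalso; apply: noP; exists (n + j).+1; first by rewrite ltnS leq_addr.
  by rewrite run_restrS IHj /= asboolT// size_map size_iota.
have [m mF] := open_restr (oF k) (Fb k I).
have := st m.+1; rewrite addnS run_restrS st /= asboolT//.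
move=> c; rewrite /cylinder/= size_map size_iota => cE; apply: mF => /=.
by apply: restr_le cE; rewrite leqW// leq_addl.
Qed.

(** As long as the round lasts, the invariant keeps [h N] below 1 on all prefixes, so the round
    cannot outlast the given [m]. *)
Lemma play_ends beta n k N x : (exists m, 1 <= h N (restr beta m)) ->
  run (restr beta n) = Play k N x ->
  exists m, [/\ (n < m)%N, 1 <= h N (restr beta m) &
    run (restr beta m) = Wait k.+1 (value (Play k N x) (restr beta m))].
Proof.
move=> [m m1] runn; apply: contrapT => noW.
have st j : run (restr beta (n + j)) = Play k N x.
  elim: j => [|j IHj]; first by rewrite addn0.
  rewrite addnS run_restrS IHj /=; case: ifP => // jh.
  exfalso; apply: noW; exists (n + j).+1.
  by rewrite ltnS leq_addr run_restrS IHj /= jh.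
have := phase_inv_run (restr beta (n + m)); rewrite st => -[_ _ /(_ m) + _].
by rewrite take_restr ?leq_addl// ltNge m1.
Qed.

Lemma phase_martingale_jump beta n : (\bigcap_k F k) beta ->
  (forall N, exists m, 1 <= h N (restr beta m)) ->
  exists p q, [/\ (n <= p)%N, (n <= q)%N & 1 / 16 <=
    `|phase_martingale (restr beta p) - phase_martingale (restr beta q)|].
Proof.
move=> Fb hb.
(* A round in progress at [n] may have little left to gain, so the jump is measured over the next
   complete one. *)
have [p [k [x [np runp]]]] : exists p k x, (n <= p)%N /\
    run (restr beta p) = Play k p x.
  case E : (run (restr beta n)) => [k x|k N x].
    by have [m nm Em] := wait_ends Fb E; exists m, k, x; rewrite ltnW.
  have [m [nm _ Em]] := play_ends (hb N) E.
  have [m' mm' Em'] := wait_ends Fb Em.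
  by exists m'; do 2 eexists; split; last exact: Em'; exact/ltnW/(ltn_trans nm).
have [q [pq hq runq]] := play_ends (hb p) runp.
exists p, q; split => //; first by rewrite (leq_trans np)// ltnW.
rewrite /phase_martingale runp runq /= !take_restr ?(ltnW pq)// subrr.
have hp : h p (restr beta p) <= 1 / 2 by apply: hN; rewrite size_restr.
by rewrite ler_normr /direction; apply/orP; case: ifP => _; [right|left]; lra.
Qed.

End phases.

(** * From one null [Gdelta] set to countable unions *)

Lemma null_Gdelta_martingale (G : set cantor_space) :
  Gdelta G -> fair_coin R G = 0%E ->
  exists f : seq bool -> R, [/\ martingale f,
    forall beta, G beta -> forall n, exists p q, [/\ (n <= p)%N, (n <= q)%N &
      1 / 16 <= `|f (restr beta p) - f (restr beta q)|] &
    forall beta, ~ G beta -> cvgn (fun n => f (restr beta n))].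
Proof.
move=> [F oF GE] G0.
have [h Hh] := choice (fun N => @null_martingale G N G0).
have h0 N s : 0 <= h N s by have [] := Hh N.
have hm N s : h N s = step (h N) s by have [] := Hh N.
have hN N s : (size s <= N)%N -> h N s <= 1 / 2 by have [_ _ H _ _] := Hh N; exact: H.
exists (phase_martingale h F); split => [|beta Gb n|beta nGb].
- exact: phase_martingaleP.
- apply: phase_martingale_jump => //; first by rewrite -GE.
  by move=> N; have [_ _ _ H _] := Hh N; exact: H.
- apply: phase_martingale_cvg => //; last by rewrite -GE.
  by move=> N; have [_ _ _ _ H] := Hh N; exact: H.
Qed.

Lemma null_Gdelta_sigma_martingale (B : set cantor_space) :
  Gdelta_sigma B -> fair_coin R B = 0%E ->
  exists2 f : seq bool -> R, martingale f & B = divergence_set f.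
Proof.
move=> [G dG BE] B0.
have G0 i : fair_coin R (G i) = 0%E.
  apply/eqP; rewrite eq_le (@measure_ge0 _ _ _ (fair_coin R)) andbT -B0 BE.
  by apply: le_fair_coin; exact: bigcup_sup.
have [g Hg] := choice (fun i => null_Gdelta_martingale (dG i) (G0 i)).
have g01 i s : 0 <= g i s <= 1 by have [[H _] _ _] := Hg i.
have gm i s : g i s = step (g i) s by have [[_ H] _ _] := Hg i; exact: H.
pose a i : R := 64 ^- i.+1; pose u i s := a i * g i s.
have a0 i : 0 < a i by rewrite invr_gt0 exprn_gt0.
have aE n : series a n = (1 - 64 ^- n) / 63.
  elim: n => [|n IHn]; first by rewrite /series/= big_nil expr0 invr1 subrr mul0r.
  rewrite seriesS IHn /a exprS; have /lt0r_neq0 : (0 : R) < 64 ^+ n by rewrite exprn_gt0.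
  by move=> ?; field.
have a_tail i n : series a n - series a i.+1 <= a i / 63.
  rewrite !aE /a; have : 0 < 64 ^- n :> R by rewrite invr_gt0 exprn_gt0.
  by lra.
have a1 n : series a n <= 1.
  by rewrite aE; have : 0 < 64 ^- n :> R by [rewrite invr_gt0 exprn_gt0]; lra.
have u0 i s : 0 <= u i s.
  by have /andP[? _] := g01 i s; rewrite mulr_ge0// ltW.
have ua i s : u i s <= a i.
  by have /andP[_ ?] := g01 i s; rewrite ler_piMr// ltW.
have uC s n : series (u^~ s) n <= 1 by apply: le_trans (a1 n); exact: series_le.
pose f s := limn (series (u^~ s)).
exists f.
  split=> s.
    apply/andP; split; last exact: lim_series_le (u0^~ s) (uC s).
    apply: le_trans (series_le_lim (u0^~ s) (uC s) 0%N).
    by rewrite /series/= big_nil.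
  apply: lim_series_martingale u0 _ uC s => i s.
  by rewrite /u (gm i s) /step; field.
rewrite BE; apply/seteqP; split=> beta; last first.
  move=> /divergence_setE; apply: contra_notP => nBb.
  apply: (@tannery (fun i m => u i (restr beta m)) a 1) => //.
    by move=> i m; rewrite u0/= ua.
  move=> i; apply: is_cvgMl_tmp; have [_ _] := Hg i; apply => Gb.
  by apply: nBb; exists i.
move=> [j _ Gj]; apply/divergence_setE => cf.
have ex : exists i, `[< G i beta >] by exists j; exact: asboolT.
case: (ex_minnP ex) => i /asboolP Gi imin {j Gj ex}.
(* By minimality of [i] the earlier terms converge along [beta], so convergence of [f] would pass to
   [T], which is [u i] up to an error of at most [a i / 63]. *)
pose T m := f (restr beta m) - series (u^~ (restr beta m)) i.
have cT : cvgn T.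
  apply: is_cvgB => //; apply/cvg_ex.
  exists (\sum_(0 <= j < i) limn (fun m => u j (restr beta m))).
  rewrite /series/= big_mkord; under eq_fun do rewrite big_mkord.
  apply: cvg_big => [|j _]; first exact: add_continuous.
  apply: is_cvgMl_tmp; have [_ _] := Hg j; apply => Gb.
  have /imin : `[< G j beta >] by exact: asboolT.
  by rewrite leqNgt ltn_ord.
have rT m : u i (restr beta m) <= T m <= u i (restr beta m) + a i / 63.
  have := series_le_lim (u0^~ (restr beta m)) (uC (restr beta m)) i.+1.
  have : limn (series (u^~ (restr beta m))) <=
      series (u^~ (restr beta m)) i.+1 + a i / 63.
    apply: (lim_series_le_tail (u0^~ _) (uC _)) => n ni.
    by apply: le_trans (a_tail i n); apply: series_le_diff => // k; exact: ua.
  by rewrite /T /f seriesS => ? ?; apply/andP; split; lra.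
(* Two late values of [T] are then within [a i / 32], so those of [u i] are within
   [a i / 32 + a i / 63], less than the jump [a i / 16]. *)
have e0 : 0 < a i / 64 by rewrite divr_gt0.
have [n _ Hn] := (cvgrPdist_le _ _).1 cT _ e0.
have [_ /(_ _ Gi n)[p [q [np nq jump]]] _] := Hg i.
move: jump.
apply/negP; rewrite -ltNge.
have := rT p; have := rT q; have := Hn p np; have := Hn q nq; have := a0 i.
rewrite /u/= !ler_norml ltr_norml.
set l := limn _; move=> ? /andP[? ?] /andP[? ?] /andP[? ?] /andP[? ?].
by apply/andP; split; rewrite -(ltr_pM2l (a0 i)); lra.
Qed.

End divergence_sets.

Theorem theorem1p3 (R : realType) (B : set cantor_space) :
  (Gdelta_sigma B /\ fair_coin R B = 0%E) <->
  (exists2 f : seq bool -> R, martingale f & B = divergence_set f).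
Proof.
split=> [[]|[f mf ->]]; first exact: null_Gdelta_sigma_martingale.
split; first exact: divergence_set_Gdelta_sigma.
exact: fair_coin_divergence_set.
Qed.
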